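(* Let $G$ be a graph with minimum degree $2$ and maximum degree $\Delta \geq 28$. Then $$GA_1(G) \geq 2\Delta \frac{2\sqrt{2\Delta}}{\Delta + 2},$$ and equality holds if and only if $G = K_{2,\Delta}$.
   Context: All graphs are finite, simple (no loops or multiple edges) and have at least one edge. For a vertex $u$, $d_u$ denotes its degree. The geometric-arithmetic index of $G$ is $GA_1(G) = \sum_{uv \in E(G)} \frac{2\sqrt{d_u d_v}}{d_u + d_v}$. $K_{2,\Delta}$ is the complete bipartite graph with parts of sizes $2$ and $\Delta$. *)

(* Defs.v *)
From HB Require Import structures.
From mathcomp Require Import all_boot all_order all_algebra reals.

Set Implicit Arguments.
Unset Strict Implicit.
Unset Printing Implicit Defensive.

Import Order.TTheory GRing.Theory Num.Theory.
Local Open Scope ring_scope.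

Record sgraph := SGraph {
  vertex :> finType;
  adj : rel vertex;
  adj_sym : symmetric adj;
  adj_irr : irreflexive adj }.

Definition edges (G : sgraph) : {set {set G}} :=
  [set e | [exists u : G, exists v : G, adj u v && (e == [set u; v])]].

Definition degree (G : sgraph) (u : G) : nat := #|[set v : G | adj u v]|.

Definition is_min_degree (G : sgraph) (k : nat) : Prop :=
  (exists u : G, degree u = k) /\ (forall u : G, (k <= degree u)%N).

Definition is_max_degree (G : sgraph) (k : nat) : Prop :=
  (exists u : G, degree u = k) /\ (forall u : G, (degree u <= k)%N).

(* An edge is a two-element set [set u; v], so the product and the sum of the
   degrees of its elements are d_u * d_v and d_u + d_v; see GA1_weightE. *)
Definition GA1_weight (R : realType) (G : sgraph) (e : {set G}) : R :=
  2 * Num.sqrt (\prod_(u in e) (degree u)%:R) / \sum_(u in e) (degree u)%:R.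

Definition GA1 (R : realType) (G : sgraph) : R :=
  \sum_(e in edges G) GA1_weight R e.

Lemma GA1_weightE (R : realType) (G : sgraph) (u v : G) : adj u v ->
  GA1_weight R [set u; v] =
  2 * Num.sqrt ((degree u)%:R * (degree v)%:R) /
  ((degree u)%:R + (degree v)%:R).
Proof.
move=> uv; have u'v : u \notin [set v].
  by rewrite inE; apply: contraTneq uv => ->; rewrite adj_irr.
by rewrite /GA1_weight !big_setU1 ?big_set1.
Qed.

Definition K_adj (m n : nat) : rel ('I_m + 'I_n)%type :=
  fun x y => match x, y with
             | inl _, inr _ | inr _, inl _ => true
             | _, _ => false
             end.

Lemma K_adj_sym (m n : nat) : symmetric (@K_adj m n).
Proof. by case=> ? []. Qed.

Lemma K_adj_irr (m n : nat) : irreflexive (@K_adj m n).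
Proof. by case. Qed.

Definition complete_bipartite (m n : nat) : sgraph :=
  SGraph (@K_adj_sym m n) (@K_adj_irr m n).

Definition isomorphic (G H : sgraph) : Prop :=
  exists2 f : G -> H, bijective f & forall u v : G, adj (f u) (f v) = adj u v.

(* Main.v *)
(* Let [v] have degree [Delta], let [N] be its neighbourhood and write
   [f(a, b) = 2 sqrt(a b) / (a + b)] and [m = f(2, Delta)], so that the bound is
   [2 m] per element of [N].  All edges weigh at least [m], and [m < 1/2]
   exactly because [Delta >= 28].  Each edge splits its weight between its ends:
   an edge leaving [N] gives everything to its end in [N], an edge of [N]
   between degrees [2] and [k >= 3] gives [m] to the end of degree [2] and
   [f(2, k) - m] to the other one, and all other edges split evenly.  Then every
   [u] in [N] collects at least [2 m]: when [u] has degree [2] this is [m] from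
   [v] and at least [m] from its other edge; when [u] has degree [k >= 3] it
   gets [f(k, Delta)] from [v] and at least [min(m/2, f(2, k) - m)] from each of
   two other edges, and [f(k, Delta) + 2 f(2, k) > 4 m].  In the equality case
   all vertices of [N] have degree [2], all their neighbours lie outside [N] and
   have degree [Delta], and no edge avoids [N]; hence every vertex outside [N]
   has neighbourhood [N], and [G = K_(2,Delta)]. *)

Require Import Defs.
From HB Require Import structures.
From mathcomp Require Import all_boot all_order all_algebra reals zify ring lra.
Import Order.TTheory GRing.Theory Num.Theory.
Local Open Scope ring_scope.

(** * Inequalities for the weight of an edge as a function of two real degrees *)

Definition ga {R : rcfType} (a b : R) : R := 2 * Num.sqrt (a * b) / (a + b).

Section GeometricArithmetic.
Variable R : rcfType.
Implicit Types a b p q t : R.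

Lemma gaC a b : ga a b = ga b a.
Proof. by rewrite /ga (mulrC a) (addrC a). Qed.

Lemma ga_sqr p q : 0 <= p -> 0 <= q ->
  ga (p ^+ 2) (q ^+ 2) = 2 * (p * q) / (p ^+ 2 + q ^+ 2).
Proof.
by move=> p0 q0; rewrite /ga -exprMn sqrtr_sqr ger0_norm ?mulr_ge0.
Qed.

Lemma ga_gt0 a b : 0 < a -> 0 < b -> 0 < ga a b.
Proof.
by move=> a0 b0; rewrite divr_gt0 ?addr_gt0 ?mulr_gt0 ?sqrtr_gt0 ?mulr_gt0.
Qed.

Lemma ga_xx a : 0 < a -> ga a a = 1.
Proof.
move=> a0; rewrite /ga -expr2 sqrtr_sqr gtr0_norm // -mulr2n mulr_natl divff //.
by rewrite mulrn_eq0 /= gt_eqF.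
Qed.

(** Replacing each variable by the square of its root makes [ga] a rational function, within reach
    of [field] and [nra]. *)
Lemma sqr_witness a : 0 <= a -> {p | 0 <= p & a = p ^+ 2}.
Proof. by move=> a0; exists (Num.sqrt a); rewrite ?sqrtr_ge0 ?sqr_sqrtr. Qed.

(** After squaring, the claim reads [32 a < (a + 2)^2], that is [a^2 - 28 a + 4 > 0]. *)
Lemma ga_lt_half a : 28 <= a -> ga 2 a < 2^-1.
Proof.
move=> ha; have [q q0 aE] := @sqr_witness a ltac:(lra).
have [t t0 tE] := @sqr_witness (2 : R) ltac:(lra).
have -> : ga 2 a = 2 * (t * q) / (t ^+ 2 + q ^+ 2) by rewrite -ga_sqr // -tE -aE.
rewrite ltr_pdivrMr; last by nra.
have : (4 * (t * q)) ^+ 2 < (t ^+ 2 + q ^+ 2) ^+ 2.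
  by rewrite !exprMn -tE -aE; nra.
rewrite ltr_pXn2r ?nnegrE ?addr_ge0 ?sqr_ge0 ?mulr_ge0 //.
lra.
Qed.

(** With the square roots [t], [p], [r], [q] of [l], [a], [b], [c], the difference is a positive
    multiple of [(r q - p t) (p q - r t)]. Since [t] is the least root and [q] the greatest, both
    factors are nonnegative, and each vanishes in exactly one of the two equality cases. *)
Lemma ga_ge l a b c : 0 < l -> l <= a <= c -> l <= b <= c ->
  ga l c <= ga a b ?= iff ((a == l) && (b == c)) || ((a == c) && (b == l)).
Proof.
move=> l0 /andP[la ac] /andP[lb bc].
have [t t0 tE] := @sqr_witness l ltac:(lra).
have [q q0 qE] := @sqr_witness c ltac:(lra).
have [p p0 pE] := @sqr_witness a ltac:(lra).
have [r r0 rE] := @sqr_witness b ltac:(lra).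
subst l c a b.
have tgt0 : 0 < t.
  by rewrite lt_def t0 andbT; apply: contraTneq l0 => ->; rewrite expr0n ltxx.
move: la ac lb bc; rewrite !ler_pXn2r ?nnegrE // => tp pq tr rq.
have diffE : ga (p ^+ 2) (r ^+ 2) - ga (t ^+ 2) (q ^+ 2) =
    2 * (r * q - p * t) * (p * q - r * t) / ((p ^+ 2 + r ^+ 2) * (t ^+ 2 + q ^+ 2)).
  rewrite !ga_sqr //; field.
  by rewrite !gt_eqF // ltr_pwDl ?sqr_ge0 // exprn_gt0 // (lt_le_trans tgt0).
have den_gt0 : 0 < (p ^+ 2 + r ^+ 2) * (t ^+ 2 + q ^+ 2).
  by rewrite mulr_gt0 // ltr_pwDl ?sqr_ge0 // exprn_gt0 // (lt_le_trans tgt0).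
have h1 : 0 <= r * q - p * t by nra.
have h2 : 0 <= p * q - r * t by nra.
split.
  by rewrite -subr_ge0 diffE divr_ge0 ?(ltW den_gt0) // !mulr_ge0.
rewrite eq_sym -subr_eq0 diffE mulf_eq0 invr_eq0 (gt_eqF den_gt0) orbF.
rewrite -mulrA mulf_eq0 pnatr_eq0 /= mulf_eq0 orbC !eqrXn2 //.
congr (_ || _); apply/eqP/andP => [h|[/eqP-> /eqP->]]; try ring.
  by split; apply/eqP; nra.
by split; apply/eqP; nra.
Qed.

(* In terms of the square roots [t <= p <= q] of [l], [b] and [c], the
   difference of both sides is a positive multiple of
   [(q^2 + t^2) B - 4 t q (q^2 t^2 + p^4)] with [B > 0]; bounding
   [q^2 + t^2 > 4 t q] leaves a multiple of [q - p]. *)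
Lemma ga_sum_gt l b c : 0 < l -> l <= b <= c -> ga l c < 2^-1 ->
  4 * ga l c < ga b c + 2 * ga b l.
Proof.
move=> l0 /andP[lb bc].
have [t t0 tE] := @sqr_witness l ltac:(lra).
have [q q0 qE] := @sqr_witness c ltac:(lra).
have [p p0 pE] := @sqr_witness b ltac:(lra).
subst l c b.
have tgt0 : 0 < t.
  by rewrite lt_def t0 andbT; apply: contraTneq l0 => ->; rewrite expr0n ltxx.
move: lb bc; rewrite !ler_pXn2r ?nnegrE // => tp pq.
have pgt0 := lt_le_trans tgt0 tp; have qgt0 := lt_le_trans pgt0 pq.
rewrite !ga_sqr // ltr_pdivrMr ?addr_gt0 ?exprn_gt0 // => m_half.
pose B := p * (q * (t ^+ 2 + p ^+ 2) + 2 * t * (q - p) ^+ 2).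
have B0 : 0 < B.
  apply: mulr_gt0 => //; apply: ltr_pwDl; last by rewrite mulr_ge0 ?sqr_ge0 // mulr_ge0.
  by rewrite mulr_gt0 // addr_gt0 ?exprn_gt0.
have main : 0 < (q ^+ 2 + t ^+ 2) * B - 4 * (t * q) * (q ^+ 2 * t ^+ 2 + p ^+ 4).
  have h : 4 * (t * q) * B < (q ^+ 2 + t ^+ 2) * B by rewrite ltr_pM2r //; lra.
  have e : B - (q ^+ 2 * t ^+ 2 + p ^+ 4) =
    (q - p) * ((q - p) * (2 * t * p - t ^+ 2) + p * (p ^+ 2 - t ^+ 2)).
    by rewrite /B; ring.
  have : 0 <= B - (q ^+ 2 * t ^+ 2 + p ^+ 4).
    rewrite e mulr_ge0 ?subr_ge0 // addr_ge0 // mulr_ge0 ?subr_ge0 //; nra.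
  have tq : 0 < t * q by rewrite mulr_gt0.
  nra.
rewrite -subr_gt0.
have -> : 2 * (p * q) / (p ^+ 2 + q ^+ 2) + 2 * (2 * (p * t) / (p ^+ 2 + t ^+ 2)) -
    4 * (2 * (t * q) / (t ^+ 2 + q ^+ 2)) =
    2 * ((q ^+ 2 + t ^+ 2) * B - 4 * (t * q) * (q ^+ 2 * t ^+ 2 + p ^+ 4)) /
    ((p ^+ 2 + q ^+ 2) * (p ^+ 2 + t ^+ 2) * (t ^+ 2 + q ^+ 2)).
  rewrite /B; field.
  by rewrite !gt_eqF ?addr_gt0 ?exprn_gt0.
apply: divr_gt0; first by rewrite mulr_gt0.
by apply: mulr_gt0; [apply: mulr_gt0|]; rewrite addr_gt0 ?exprn_gt0.
Qed.

End GeometricArithmetic.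

(** * Double counting: the index as a sum over ordered adjacent pairs *)

Lemma GA1_share {R : realType} {G : sgraph} (s : G -> G -> R) :
  (forall x y, adj x y -> s x y + s y x = GA1_weight R [set x; y]) ->
  GA1 R G = \sum_x \sum_(y | adj x y) s x y.
Proof.
move=> sE; rewrite pair_big_dep /=.
rewrite (partition_big (fun p : G * G => [set p.1; p.2]) (mem (edges G))) /=; last first.
  move=> [x y] /= xy; rewrite inE; apply/existsP; exists x; apply/existsP; exists y.
  by rewrite xy eqxx.
apply: eq_bigr => e; rewrite inE => /existsP[u /existsP[v /andP[uv /eqP->]]].
have uDv : u != v by apply: contraTneq uv => ->; rewrite adj_irr.
(* Only the ordered pairs [(u, v)] and [(v, u)] lie over this edge. *)
rewrite (bigD1 (u, v)) /= ?uv ?eqxx //.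
rewrite (bigD1 (v, u)) /=; last by rewrite adj_sym uv setUC eqxx -pair_eqE /= eq_sym (negPf uDv).
rewrite big1 ?addr0 ?sE // => -[x y] /= /andP[/andP[/andP[xy /eqP exy] nuv] nvu].
have := set21 x y; have := set22 x y; rewrite exy !inE.
by case/pred2P=> yE /pred2P[] xE; move: xy nuv nvu; rewrite xE yE ?eqxx ?adj_irr.
Qed.

(** * Recognising complete bipartite graphs *)

Lemma inj_in_ord {T : finType} {A : {set T}} {n : nat} : #|A| = n -> (0 < n)%N ->
  exists h : T -> 'I_n, {in A &, injective h}.
Proof.
move=> <- /card_gt0P[x xA]; exists (enum_rank_in xA); exact: enum_rank_in_inj.
Qed.

Lemma complete_bipartiteP {G : sgraph} {m n : nat} {A : {set G}} :
  #|~: A| = m -> #|A| = n -> (0 < m)%N -> (0 < n)%N ->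
  (forall x y, adj x y = ((x \in A) != (y \in A))) ->
  isomorphic G (complete_bipartite m n).
Proof.
move=> cm cn m0 n0 adjE.
have [g g_inj] := inj_in_ord cm m0; have [h h_inj] := inj_in_ord cn n0.
pose f x : complete_bipartite m n := if x \in A then inr (h x) else inl (g x).
exists f; last first.
  by move=> x y; rewrite adjE /f; case: (x \in A); case: (y \in A).
(* Both graphs have [m + n] vertices, so injectivity suffices. *)
apply: inj_card_bij; last first.
  by rewrite card_sum !card_ord -cm -cn addnC cardsC.
move=> x y; rewrite /f; case: ifP => xA; case: ifP => yA // [].
  exact: h_inj.
by apply: g_inj; rewrite inE ?xA ?yA.
Qed.

Lemma isomorphic_degree {G H : sgraph} {f : G -> H} : bijective f ->
  (forall u v, adj (f u) (f v) = adj u v) -> forall u, degree (f u) = degree u.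
Proof.
move=> f_bij fE u; rewrite /degree -(on_card_preimset (onW_bij _ f_bij)).
by apply: eq_card => v; rewrite !inE fE.
Qed.

Lemma degree_complete_bipartite {m n : nat} (x : complete_bipartite m n) :
  degree x = if x is inl _ then n else m.
Proof.
rewrite /degree -sum1dep_card big_sumType /=.
by case: x => i /=; rewrite ?big_pred0_eq ?sum1_card ?card_ord ?addn0.
Qed.

(** * Discharging around a vertex of maximum degree *)

Section Discharging.
Context {R : realType} {G : sgraph} {Delta : nat} {v : G}.
Context (dmin : forall u : G, (2 <= degree u)%N).
Context (dmax : forall u : G, (degree u <= Delta)%N).
Context (dv : degree v = Delta) (hDelta : (28 <= Delta)%N).

Let N := [set u | adj v u].
Let m : R := ga 2 Delta%:R.
Let g (x y : G) : R := ga (degree x)%:R (degree y)%:R.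

(** The part of the edge between [x] and [y] that [x] receives; adjacency is imposed only in
    [charge]. *)
Definition share (x y : G) : R :=
  if x \in N then
    if y \in N then
      match degree x == 2%N, degree y == 2%N with
      | true, false => m
      | false, true => g x y - m
      | _, _ => g x y / 2
      end
    else g x y
  else if y \in N then 0 else g x y / 2.

Definition charge (x : G) : R := \sum_(y | adj x y) share x y.

Lemma m_gt0 : 0 < m.
Proof. by rewrite ga_gt0 // ltr0n; lia. Qed.

Lemma m_lt_half : m < 2^-1.
Proof. by rewrite ga_lt_half // ler_nat. Qed.

Lemma m_le_g x y : m <= g x y ?= iff
  (degree x == 2%N) && (degree y == Delta) || (degree x == Delta) && (degree y == 2%N).
Proof.
have := @ga_ge R 2 (degree x)%:R (degree y)%:R Delta%:R.
by rewrite !ler_nat !eqr_nat !dmin !dmax; exact.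
Qed.

Lemma share_sum x y : share x y + share y x = g x y.
Proof.
have gC : g y x = g x y by rewrite /g gaC.
rewrite /share gC; case: (x \in N); case: (y \in N); rewrite ?add0r ?addr0 -?splitr //.
by case: (_ == _); case: (_ == _); rewrite -?splitr ?subrK ?subrKC.
Qed.

Lemma share_ge0 x y : 0 <= share x y.
Proof.
have [mg _] := m_le_g x y; have m0 := m_gt0.
by rewrite /share; do ![case: (_ \in _) | case: (_ == _)]; lra.
Qed.

Lemma charge_ge0 x : 0 <= charge x.
Proof. by apply: sumr_ge0 => y _; exact: share_ge0. Qed.

Lemma share_out x y : x \in N -> y \notin N -> share x y = g x y.
Proof. by rewrite /share => -> /negPf->. Qed.

Lemma v_notin_N : v \notin N. Proof. by rewrite inE adj_irr. Qed.

(** A neighbour in [N] of degree other than 2 also gives exactly [m], so the equality condition has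
    to allow it. It is excluded only once all of [N] is known to have degree 2. *)
Lemma charge_degree2 x : x \in N -> degree x = 2%N -> 2 * m <= charge x ?= iff
  [forall (y | adj x y), if y \in N then degree y != 2%N else degree y == Delta].
Proof.
move=> xN dx; have m_half := m_lt_half.
have [a [b [ab nbE]]] : exists a b, a != b /\ [set y | adj x y] = [set a; b].
  by move/eqP/cards2P: (dx) => [a [b [ab ->]]]; exists a, b.
have adjE y : adj x y = (y \in [set a; b]) by rewrite -nbE inE.
wlog av : a b ab nbE adjE / a = v.
  move=> wl; have : v \in [set a; b] by rewrite -adjE adj_sym -[adj v x]inE.
  rewrite !inE => /orP[/eqP/esym|/eqP/esym]; first exact: (wl a b).
  by apply: (wl b a); rewrite 1?setUC // eq_sym.
subst a.
have -> : [forall (y | adj x y),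
      if y \in N then degree y != 2%N else degree y == Delta] =
    if b \in N then degree b != 2%N else degree b == Delta.
  apply/forall_inP/idP => [/(_ b)|hb y]; first by apply; rewrite adjE set22.
  by rewrite adjE !inE => /orP[]/eqP->; rewrite ?adj_irr ?dv ?eqxx // -[adj v b]inE.
have -> : charge x = m + share x b.
  rewrite /charge (eq_bigl _ _ adjE) big_setU1 ?inE //= big_set1.
  rewrite share_out ?v_notin_N //; congr (_ + _).
  by apply/esym/eqP; rewrite (m_le_g x v) dx dv !eqxx.
suff [le_b eq_b] : m <= share x b ?= iff
    (if b \in N then degree b != 2%N else degree b == Delta).
  by rewrite mulrDl mul1r; split; rewrite ?lerD2l ?(inj_eq (addrI _)).
rewrite /share xN dx eqxx; case: ifP => bN.
  have [db|_] := eqVneq (degree b) 2%N; last exact/leif_refl.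
  (* An edge between two vertices of degree 2 has weight 1, and its half exceeds [m]. *)
  by rewrite /g dx db ga_xx ?ltr0n // mul1r; split; [exact: ltW|exact: lt_eqF].
have := m_le_g x b; rewrite dx eqxx /= => h; split; first exact: h.
rewrite (eq_leif h); case: eqVneq => // _; apply/andP => -[/eqP hD /eqP].
by lia.
Qed.

Lemma charge_gt x : x \in N -> degree x != 2%N -> 2 * m < charge x.
Proof.
move=> xN dx; have m_half := m_lt_half.
have xv : adj x v by rewrite adj_sym -[adj v x]inE.
have dx3 : (2 < degree x)%N by rewrite ltn_neqAle eq_sym dx dmin.
have /card_gt1P[y [z [yA zA yz]]] : (1 < #|[set y | adj x y] :\ v|)%N.
  by move: dx3; rewrite /degree (cardsD1 v) inE xv.
move: yA zA; rewrite !inE => /andP[yv xy] /andP[zv xz].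
have ge3 : share x v + (share x y + share x z) <= charge x.
  rewrite /charge (bigD1 v) //= (bigD1 y) ?xy //= (bigD1 z) ?xz ?zv 1?eq_sym //=.
  by rewrite lerD2l lerD2l lerDl sumr_ge0 // => w _; exact: share_ge0.
apply: lt_le_trans ge3; rewrite share_out ?v_notin_N //.
have gv : m < g x v.
  rewrite (lt_leif (m_le_g x v)) dv eqxx (negPf dx) andbT /=.
  by apply/andP => -[_ /eqP]; lia.
have sum4 : 4 * m < g x v + 2 * ga (degree x)%:R 2.
  by rewrite /g dv; apply: ga_sum_gt => //; rewrite !ler_nat dmin dmax.
have low w : (m / 2 <= share x w) || (ga (degree x)%:R 2 - m <= share x w).
  have [mg _] := m_le_g x w; have m0 := m_gt0.
  rewrite /share xN (negPf dx); case: ifP => wN.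
    case: eqVneq => [dw|_]; first by rewrite /g dw lexx orbT.
    by apply/orP; left; lra.
  by apply/orP; left; lra.
(* Two shares of the first kind are settled by [gv], two of the second by [sum4]; the mixed case is
   the average of these two inequalities. *)
by case/orP: (low y); case/orP: (low z); lra.
Qed.

Lemma charge_ge x : x \in N ->
  2 * m <= charge x ?= iff (degree x == 2%N) &&
  [forall (y | adj x y), if y \in N then degree y != 2%N else degree y == Delta].
Proof.
move=> xN; have [dx|dx] := eqVneq; first exact: charge_degree2.
by have h := charge_gt _ xN dx; split; [exact: ltW|rewrite lt_eqF].
Qed.

Lemma GA1_charge : GA1 R G = \sum_x charge x.
Proof. by apply: GA1_share => x y xy; rewrite share_sum GA1_weightE. Qed.

Lemma card_N : #|N| = Delta. Proof. by rewrite -dv. Qed.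

Lemma GA1_ge : 2 * Delta%:R * m <= GA1 R G.
Proof.
rewrite GA1_charge (bigID (mem N)) /= -[leLHS]addr0 lerD //; last first.
  by rewrite sumr_ge0 // => x _; exact: charge_ge0.
have -> : 2 * Delta%:R * m = \sum_(x in N) (2 * m).
  by rewrite sumr_const card_N -mulr_natr; ring.
by apply: ler_sum => x xN; exact: (charge_ge _ xN).
Qed.

Lemma GA1_eq_isomorphic : GA1 R G = 2 * Delta%:R * m ->
  isomorphic G (complete_bipartite 2 Delta).
Proof.
(* The zeros outside [N] let equality of the totals split into equality at every vertex. *)
have -> : 2 * Delta%:R * m = \sum_(x in N) (2 * m) + \sum_(x | x \notin N) 0.
  by rewrite sumr_const card_N big1_eq addr0 -mulr_natr; ring.
rewrite GA1_charge (bigID (mem N)) /= => /esym/eqP.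
have leN : \sum_(x in N) (2 * m) <= \sum_(x in N) charge x ?= iff
    [forall (x | x \in N), (degree x == 2%N) && [forall (y | adj x y),
       if y \in N then degree y != 2%N else degree y == Delta]].
  by apply: leif_sum => x; exact: charge_ge.
have leC : \sum_(x | x \notin N) 0 <= \sum_(x | x \notin N) charge x ?= iff
    [forall (x | x \notin N), charge x == 0].
  by apply: leif_sum => x _; split; rewrite ?charge_ge0 // eq_sym.
rewrite (eq_leif (leifD leN leC)) => /andP[/forall_inP eqN /forall_inP eqC].
have degN x : x \in N -> degree x = 2%N by move/eqN => /andP[/eqP].
have nbN x y : x \in N -> adj x y -> y \notin N /\ degree y = Delta.
  move=> xN xy; have /andP[_ /forall_inP /(_ y xy)] := eqN x xN.
  by case: ifP => yN; [rewrite degN|move/eqP].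
have nbC x y : x \notin N -> adj x y -> y \in N.
  move=> xN xy; apply: contraTT (eqC x xN) => yN.
  rewrite gt_eqF // /charge (bigD1 y) //= ltr_pwDl //; last first.
    by rewrite sumr_ge0 // => w _; exact: share_ge0.
  rewrite /share (negPf xN) (negPf yN) divr_gt0 //.
  by apply: lt_le_trans (m_le_g x y); exact: m_gt0.
(* The neighbourhood lies in [N], and [x], being adjacent to a vertex of [N], has degree [Delta],
   the size of [N]. *)
have nbCE x : x \notin N -> [set y | adj x y] = N.
  move=> xN; apply/eqP; rewrite eqEcard card_N; apply/andP; split.
    by apply/subsetP => y; rewrite [in X in X -> _]inE; exact: nbC.
  have /card_gt0P[y] : (0 < #|[set y | adj x y]|)%N by apply: leq_trans (dmin x).
  rewrite inE => xy; have yN := nbC _ _ xN xy.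
  by have [_ ] := nbN y x yN ltac:(by rewrite adj_sym); rewrite /degree => ->.
have adjE x y : adj x y = ((x \in N) != (y \in N)).
  have adjC a b : a \notin N -> adj a b = (b \in N) by move/nbCE=> <-; rewrite inE.
  have [xN|xN] /= := boolP (x \in N); last by rewrite adjC //; case: (y \in N).
  have [yN|yN] /= := boolP (y \in N); last by rewrite adj_sym adjC.
  by apply/negP => /(nbN _ _ xN)[]; rewrite yN.
apply: (complete_bipartiteP _ card_N _ _ adjE) => //; last by lia.
(* The complement of [N] is the neighbourhood of any [y] in [N], hence has two elements. *)
have /card_gt0P[y yN] : (0 < #|N|)%N by rewrite card_N; lia.
rewrite -(degN y yN); apply: eq_card => x.
by rewrite !inE -[adj v x]inE adjE yN; case: (x \in N).
Qed.

End Discharging.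

(** * Value on complete bipartite graphs, and the conclusion *)

Lemma GA1_complete_bipartite {R : realType} {G : sgraph} {m n : nat} :
  isomorphic G (complete_bipartite m n) ->
  GA1 R G = m%:R * n%:R * ga m%:R n%:R.
Proof.
move=> [f f_bij fE].
have degE := isomorphic_degree f_bij fE.
have wE (x y : G) : adj x y -> GA1_weight R [set x; y] = ga m%:R n%:R.
  move=> xy; rewrite GA1_weightE // -/(ga _ _) -!degE.
  move: xy; rewrite -fE !degree_complete_bipartite.
  by case: (f x) => i; case: (f y) => j //= _; rewrite gaC.
(* All edges weigh the same, so even shares turn the index into half this weight times the degree
   sum [2 m n]. *)
rewrite (@GA1_share R G (fun _ _ => ga m%:R n%:R / 2)); last first.
  by move=> x y xy; rewrite -splitr wE.
transitivity (\sum_(z : complete_bipartite m n) (degree z)%:R * (ga m%:R n%:R / 2 : R)).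
  rewrite (reindex f) /=; last exact: onW_bij.
  apply: eq_bigr => x _; rewrite sumr_const degE mulr_natl.
  by rewrite /degree cardsE.
rewrite big_sumType /=.
under eq_bigr => i _ do rewrite degree_complete_bipartite.
under [X in _ + X]eq_bigr => i _ do rewrite degree_complete_bipartite.
by rewrite !sumr_const !card_ord; field.
Qed.

Theorem theorem2p20 (R : realType) (G : sgraph) (Delta : nat)
    (hE : edges G != set0)
    (hmin : is_min_degree G 2)
    (hmax : is_max_degree G Delta)
    (hDelta : (28 <= Delta)%N) :
  2 * Delta%:R * (2 * Num.sqrt (2 * Delta%:R) / (Delta%:R + 2)) <= GA1 R G /\
  (GA1 R G = 2 * Delta%:R * (2 * Num.sqrt (2 * Delta%:R) / (Delta%:R + 2)) <->
   isomorphic G (complete_bipartite 2 Delta)).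
Proof.
have [_ dmin] := hmin; have [[v dv] dmax] := hmax.
rewrite (addrC _ 2) -/(ga 2 Delta%:R); split; first exact: (GA1_ge dmin dmax dv).
split; first exact: (GA1_eq_isomorphic dmin dmax dv).
exact: GA1_complete_bipartite.
Qed.
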